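(* $\mathcal{MC} \cap \mathcal{MID} \cap \mathcal{A} = \mathcal{SL} = \mathcal{V}(\mathbf{2_s}) \subset \mathcal{CP}$, where $\subset$ denotes proper inclusion.
   Context: An implicator groupoid is an algebra $\mathbf A = \langle A, \to, 0 \rangle$, with $\to$ binary and $0$ a constant, which, writing $x' := x \to 0$, satisfies the identities (I) $(x \to y) \to z \approx [(z' \to x) \to (y \to z)']'$ and (I$_0$) $0'' \approx 0$. Put $x \land y := (x \to y')'$. The following are varieties of implicator groupoids, each defined by the indicated identities: $\mathcal{MC}$: $x \land y \approx y \land x$; $\mathcal{MID}$: $x \land x \approx x$; $\mathcal{A}$: $(x \to y) \to z \approx x \to (y \to z)$; $\mathcal{CP}$: $x \to y' \approx y \to x'$; $\mathcal{SL}$: both $x' \approx x$ and $x \to y \approx y \to x$. $\mathbf{2_s}$ is the implicator groupoid on $\{0,1\}$ with $0 \to 0 = 0$ and $0 \to 1 = 1 \to 0 = 1 \to 1 = 1$. $\mathcal{V}(\mathbf{B})$ denotes the variety generated by the algebra $\mathbf{B}$. *)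

(* Defs.v *)
From mathcomp Require Import all_boot.
From mathcomp Require Import boolp classical_sets.

Set Implicit Arguments.
Unset Strict Implicit.
Unset Printing Implicit Defensive.

Local Open Scope classical_set_scope.

(* Algebras of type (2, 0), i.e. <A, ~>, 0>. *)
Record algebra : Type := Algebra {
  carrier :> Type;
  imp : carrier -> carrier -> carrier;
  const0 : carrier
}.

Arguments const0 {a}.

Notation "x ~> y" := (imp x y) (at level 55, right associativity).

Definition neg (A : algebra) (x : A) : A := x ~> const0.

Definition meet (A : algebra) (x y : A) : A := neg (x ~> neg y).

Definition implicator_groupoid : set algebra := [set A : algebra |
  (forall x y z : A,
     (x ~> y) ~> z = neg ((neg z ~> x) ~> neg (y ~> z))) /\
  neg (neg (@const0 A)) = const0].

Definition MC : set algebra := [set A : algebra |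
  implicator_groupoid A /\ forall x y : A, meet x y = meet y x].

Definition MID : set algebra := [set A : algebra |
  implicator_groupoid A /\ forall x : A, meet x x = x].

Definition Assoc : set algebra := [set A : algebra |
  implicator_groupoid A /\
  forall x y z : A, (x ~> y) ~> z = x ~> (y ~> z)].

Definition CP : set algebra := [set A : algebra |
  implicator_groupoid A /\ forall x y : A, x ~> neg y = y ~> neg x].

Definition SL : set algebra := [set A : algebra |
  implicator_groupoid A /\
  (forall x : A, neg x = x) /\ (forall x y : A, x ~> y = y ~> x)].

(* The elements 0 and 1 are false and true. *)
Definition two_s : algebra := @Algebra bool orb false.

Definition is_hom (A B : algebra) (f : A -> B) : Prop :=
  (forall x y : A, f (x ~> y) = f x ~> f y) /\ f const0 = const0.

Definition subalgebra (A : algebra) (S : set A)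
    (S_imp : forall x y : A, S x -> S y -> S (x ~> y)) (S0 : S const0) :
    algebra :=
  @Algebra {x : A | S x}
    (fun u v => exist S (sval u ~> sval v)
                  (S_imp (sval u) (sval v) (svalP u) (svalP v)))
    (exist S const0 S0).

Definition product (I : Type) (F : I -> algebra) : algebra :=
  @Algebra (forall i : I, F i) (fun u v i => u i ~> v i) (fun=> const0).

(* Closure under homomorphic images, subalgebras and direct products (HSP). *)
Definition is_variety (K : set algebra) : Prop :=
  [/\ K !=set0,
      (forall (A B : algebra) (f : A -> B),
         K A -> is_hom f -> (forall y : B, exists x : A, f x = y) -> K B),
      (forall (A : algebra) (S : set A)
         (S_imp : forall x y : A, S x -> S y -> S (x ~> y)) (S0 : S const0),
         K A -> K (subalgebra S_imp S0)) &
      (forall (I : Type) (F : I -> algebra),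
         (forall i : I, K (F i)) -> K (product F))].

Definition generated_variety (B : algebra) : set algebra :=
  smallest is_variety [set B].

(* Main.v *)
Require Import Defs.
From mathcomp Require Import all_boot.
From mathcomp Require Import boolp classical_sets.

Set Implicit Arguments.
Unset Strict Implicit.

Local Open Scope classical_set_scope.

(** The members of [SL] are the join-semilattices with least element [const0],
    the join being [~>] (lemmas [SL_unit], [SL_idem] and [SL_assoc]): when [neg]
    is the identity, identity (I) reads [(x y) z = (z x) (y z)], from which
    idempotence, then the absorption [z (y z) = y z], then associativity follow.

    The inclusion of [MC], [MID] and [Assoc] together in [SL] rests on [0' = 0]:
    under associativity [0''] is [000] and the meet of [0] with itself is
    [0000], and both are [0].  Since [x] is then [x x 0], multiplying by [0]
    on the right fixes every [x], and the meet is the operation [~>] itself.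

    That [SL] is generated by the two-element semilattice is the usual
    representation of a semilattice by its principal ideals: each [a] gives a
    homomorphism onto false and true that sends the ideal [x <= a] to false
    ([ideal_char_hom]), and these homomorphisms together separate points, so
    that the semilattice is isomorphic to a subalgebra of a power of [two_s].

    Finally [CP] is contraposition, which in [SL] is commutativity, whereas the
    two-element Boolean algebra with its implication satisfies contraposition
    and has a negation without fixed points. *)

Section SemilatticeLaws.

Variables (A : algebra) (A_SL : SL A).

Lemma SL_neg (x : A) : neg x = x.
Proof. by case: A_SL => _ []. Qed.

Lemma SL_comm (x y : A) : x ~> y = y ~> x.
Proof. by case: A_SL => _ []. Qed.

Lemma SL_unit (x : A) : x ~> const0 = x.
Proof. exact: SL_neg. Qed.

Lemma SL_imp_distr (x y z : A) : (x ~> y) ~> z = (z ~> x) ~> (y ~> z).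
Proof. by case: A_SL => -[H _] _; rewrite H !SL_neg. Qed.

(** Distributivity at [x = y = const0], which is a two-sided unit. *)
Lemma SL_idem (x : A) : x ~> x = x.
Proof.
have := SL_imp_distr const0 const0 x.
by rewrite SL_unit (SL_comm const0) SL_unit.
Qed.

(** Distributivity at [x = const0]. *)
Lemma SL_absorb (y z : A) : z ~> (y ~> z) = y ~> z.
Proof.
by have := SL_imp_distr const0 y z; rewrite (SL_comm const0) !SL_unit.
Qed.

(** Distributivity is applied twice: [(x y) z = (z x) (y z)], and the latter is
    [((y z) z) (x (y z))], which absorption reduces to [x (y z)]. *)
Lemma SL_assoc (x y z : A) : (x ~> y) ~> z = x ~> (y ~> z).
Proof.
rewrite SL_imp_distr SL_imp_distr (SL_comm (y ~> z) z) SL_absorb.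
exact: SL_absorb.
Qed.

(** In a semilattice, [x ~> a = a] is the order relation [x <= a]. *)
Lemma SL_join_le (x y a : A) :
  (x ~> y) ~> a = a <-> x ~> a = a /\ y ~> a = a.
Proof.
split=> [H|[Hx Hy]]; last by rewrite SL_assoc Hy.
split; rewrite -{1}H.
  by rewrite -SL_assoc -SL_assoc SL_idem.
by rewrite (SL_comm x) -SL_assoc -SL_assoc SL_idem -(SL_comm x).
Qed.

End SemilatticeLaws.

Lemma MC_MID_Assoc_SL : MC `&` MID `&` Assoc = SL.
Proof.
apply/seteqP; split=> A /=; last first.
  move=> A_SL; have A_IG : implicator_groupoid A by case: A_SL.
  have meetE (x y : A) : meet x y = x ~> y by rewrite /meet !(SL_neg A_SL).
  split; last by split=> // x y z; apply: SL_assoc.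
  split; split=> // x; last by rewrite meetE; apply: SL_idem.
  by move=> y; rewrite !meetE; apply: SL_comm.
move=> [[[A_IG meetC] [_ meetI]] [_ impA]].
have zero3 : (@const0 A ~> const0) ~> const0 = const0 by case: A_IG.
have meetE (x y : A) : meet x y = x ~> y ~> const0 ~> const0.
  by rewrite /meet /neg !impA.
have zero2 : @const0 A ~> const0 = const0.
  by have := meetI const0; rewrite meetE -(impA const0 const0 const0) zero3.
have negE (x : A) : neg x = x.
  by rewrite /neg -[in LHS](meetI x) meetE !impA !zero2 -[RHS]meetI meetE zero2.
split=> //; split=> // x y.
by have := meetC x y; rewrite /meet !negE.
Qed.

Lemma SL_variety : is_variety SL.
Proof.
split.
- exists two_s; split; last by split; case => // [] [].
  by split=> //; case; case; case.
- move=> A B f [[HI H0] [HN HC]] [f_imp f_0] f_surj.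
  have f_neg (x : A) : f (neg x) = neg (f x) by rewrite /neg f_imp f_0.
  split; first split.
  + move=> x y z; have [a <-] := f_surj x; have [b <-] := f_surj y.
    have [c <-] := f_surj z.
    by rewrite -f_neg -!f_imp HI !(f_neg, f_imp).
  + by rewrite -f_0 -!f_neg H0.
  + split=> [x|x y]; have [a <-] := f_surj x; first by rewrite -f_neg HN.
    by have [b <-] := f_surj y; rewrite -!f_imp HC.
- move=> A S S_imp S0 [[HI H0] [HN HC]].
  have sval_inj (u v : subalgebra S_imp S0) : sval u = sval v -> u = v.
    by case: u v => [x Sx] [y Sy] /= E; apply: eq_exist.
  split; first split.
  + by move=> x y z; apply: sval_inj; apply: HI.
  + by apply: sval_inj; apply: H0.
  + split=> [x|x y]; apply: sval_inj; first exact: HN.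
    exact: HC.
- move=> I F F_SL; split; first split.
  + by move=> x y z; apply: functional_extensionality_dep => i;
      case: (F_SL i) => -[HI _] _; apply: HI.
  + by apply: functional_extensionality_dep => i; case: (F_SL i) => -[].
  + split=> [x|x y]; apply: functional_extensionality_dep => i;
      case: (F_SL i) => _ [HN HC]; [exact: HN|exact: HC].
Qed.

Lemma two_s_SL : SL two_s.
Proof.
by split; [split=> //; case; case; case|split; case=> // [] []].
Qed.

(** The characteristic function of the complement of the ideal below [a]: the
    complement, because the least element must go to false. *)
Definition ideal_char (A : algebra) (a x : A) : two_s := ~~ `[< x ~> a = a >].

Lemma ideal_char_hom (A : algebra) (a : A) : SL A -> is_hom (ideal_char a).
Proof.
move=> A_SL; split=> [x y|].
  rewrite /ideal_char /= -negb_and; congr (~~ _).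
  rewrite -asbool_and; apply: asbool_equiv_eq; exact: SL_join_le.
by rewrite /ideal_char asboolT // (SL_comm A_SL) (SL_unit A_SL).
Qed.

(** Each of [x] and [y] lies in its own ideal, hence in that of the other, and
    the order is antisymmetric. *)
Lemma ideal_char_separates (A : algebra) (x y : A) :
  SL A -> (forall a, ideal_char a x = ideal_char a y) -> x = y.
Proof.
move=> A_SL sep.
have le_of (u v : A) : ideal_char v u = ideal_char v v -> u ~> v = v.
  by move/negb_inj; rewrite (asboolT (SL_idem A_SL v)) => /asboolP.
by rewrite -(le_of y x) ?sep // (SL_comm A_SL) le_of ?sep.
Qed.

(** An injective homomorphism identifies its source with a subalgebra of its
    target; the source is recovered as a homomorphic image of that subalgebra,
    under the inverse map. *)
Lemma variety_embedding (K : set algebra) (A B : algebra) (f : A -> B) :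
  is_variety K -> K B -> is_hom f -> (forall x y, f x = f y -> x = y) -> K A.
Proof.
move=> [_ K_hom K_sub _] KB [f_imp f_0] f_inj.
pose S : set B := range f.
have S_imp (u v : B) : S u -> S v -> S (u ~> v).
  by move=> [x _ <-] [y _ <-]; exists (x ~> y); rewrite ?f_imp.
have S0 : S const0 by exists const0.
have inv (u : subalgebra S_imp S0) : {x : A | f x = sval u}.
  by apply: cid; case: u => /= u [x _ <-]; exists x.
apply: (K_hom _ A (fun u => sval (inv u)) (K_sub B S S_imp S0 KB)).
  split=> [u v|]; apply: f_inj; last by rewrite (svalP (inv _)) f_0.
  by rewrite f_imp !(svalP (inv _)).
move=> x; exists (exist S (f x) (imageP f I)).
by apply: f_inj; rewrite (svalP (inv _)).
Qed.

Lemma SL_generated : SL = generated_variety two_s.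
Proof.
apply/seteqP; split=> [A A_SL K [K_var K2]|A]; last first.
  by apply; split; [exact: SL_variety|move=> _ ->; exact: two_s_SL].
pose power : algebra := @product A (fun=> two_s).
have K_power : K power by case: (K_var) => _ _ _; apply=> _; apply: K2.
apply: (@variety_embedding K A power (fun x a => ideal_char a x) K_var K_power).
  split=> [x y|]; apply: functional_extensionality_dep => a;
    by case: (ideal_char_hom a A_SL).
move=> x y E; apply: ideal_char_separates => // a.
exact: (congr1 (fun h => h a) E).
Qed.

Definition boolean_two : algebra := @Algebra bool implb false.

Lemma SL_proper_CP : SL `<` CP.
Proof.
split=> [A A_SL|CP_SL].
  by split=> [|x y]; [case: A_SL|rewrite !(SL_neg A_SL) (SL_comm A_SL)].
have : CP boolean_two.
  by split; [split=> //; case; case; case|case; case].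
by case/CP_SL=> _ [/(_ true)].
Qed.

Theorem corollary11p3 :
  MC `&` MID `&` Assoc = SL /\
  SL = generated_variety two_s /\
  generated_variety two_s `<` CP.
Proof.
rewrite -SL_generated; split; first exact: MC_MID_Assoc_SL.
by split; [|exact: SL_proper_CP].
Qed.
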